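(* Let $(\mathbb X,\mathcal E)$ be a quasi-regular strongly local Dirichlet space, $\mathsf d\colon X\times X\to[0,\infty]$ an extended pseudo-distance, and $\mu$ a $\sigma$-finite Borel measure not charging $\mathcal E$-polar sets which is $\mathcal E$-moderate. Assume that: (a) $(\mathbb X,\mathcal E,\mathsf d,\mu)$ possesses the Rademacher property and the Sobolev-to-Lipschitz property; (b) $\mathsf d(\cdot,A)$ is $\Sigma$-measurable for every $A\in\Sigma$, and $\mathsf d$ is $\tau$-admissible. Then for each $A\in\Sigma$ there exists $\tilde A\in\Sigma$ with $\tilde A\subset A$, with $A\triangle\tilde A$ $\mathfrak m$-negligible, and $$\bar{\mathsf d}_{\mu,A}=\bar{\mathsf d}_{\mu,\tilde A}=\mathsf d(\cdot,\tilde A)=\mathsf d_\mu(\cdot,\tilde A)\qquad\mathfrak m\text{-a.e.}$$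
   Context: Setting. $\mathbb X=(X,\tau,\Sigma,\mathfrak m)$, where $(X,\tau)$ is a topological Luzin space (Hausdorff and a continuous injective image of a Polish space), $\mathcal B_\tau$ is its Borel $\sigma$-algebra, $\mathfrak m$ is a positive $\sigma$-finite measure with full $\tau$-support, and $\Sigma$ is a $\sigma$-algebra with $\mathcal B_\tau\subset\Sigma\subset\mathcal B_\tau^{\mathfrak m}$ (the $\mathfrak m$-completion). A Dirichlet space $(\mathbb X,\mathcal E)$ carries a symmetric Dirichlet form $(\mathcal E,\mathcal F)$ on $L^2(\mathfrak m)$ (densely defined, closed, Markovian); $\mathcal F$ has norm $(\mathcal E(f,f)+\|f\|_{L^2}^2)^{1/2}$, and $\mathcal F_b=\mathcal F\cap L^\infty(\mathfrak m)$. Quasi-notions. For Borel $A$, $\mathcal F_A=\{u\in\mathcal F: u=0\ \mathfrak m\text{-a.e. on }X\setminus A\}$. An $\mathcal E$-nest is an increasing sequence $(F_n)$ of $\tau$-closed sets with $\bigcup_n\mathcal F_{F_n}$ dense in $\mathcal F$. A set $N$ is $\mathcal E$-polar if $N\subset X\setminus\bigcup_nF_n$ for some $\mathcal E$-nest; $\mathcal E$-q.e. means outside an $\mathcal E$-polar set. $G$ is $\mathcal E$-quasi-open if for some $\mathcal E$-nest $(F_n)$ each $G\cap F_n$ is relatively open in $F_n$ (quasi-open sets are always taken Borel). A function is $\mathcal E$-quasi-continuous if its restriction to each $F_n$ is continuous for some $\mathcal E$-nest; $\widetilde f$ denotes an $\mathcal E$-quasi-continuous representative of $f$. $(\mathbb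 X,\mathcal E)$ is quasi-regular if: there is an $\mathcal E$-nest of compact sets; a dense subset of $\mathcal F$ has $\mathcal E$-quasi-continuous representatives; there are an $\mathcal E$-polar $N$ and countably many $u_n\in\mathcal F$ with $\mathcal E$-quasi-continuous representatives separating points of $X\setminus N$. It is strongly local if $\mathcal E(f,g)=0$ whenever $f,g\in\mathcal F$ have compact support and $f$ is constant on a neighborhood of $\operatorname{supp} g$. Broad local spaces. $\mathscr G$ is the set of sequences $G_\bullet=(G_n)$ of $\mathcal E$-quasi-open sets with $G_n\subset G_{n+1}$ $\mathcal E$-q.e. and $\bigcup_nG_n=X$ $\mathcal E$-q.e. For a family $\mathscr A$ of $\mathfrak m$-classes of functions, $\mathscr A^\bullet_{\mathrm{loc}}$ is the set of classes $f$ for which there are $G_\bullet\in\mathscr G$ and $f_n\in\mathscr A$ with $f=f_n$ $\mathfrak m$-a.e. on $G_n$ for all $n$. One has $\mathcal F^\bullet_{\mathrm{loc}}=(\mathcal F_b)^\bullet_{\mathrm{loc}}$. Energy measures. For $f\in\mathcal F_b$, $\mu_{\langle f\rangle}$ is the unique finite Borel measure not charging $\mathcal E$-polar sets with $\int\widetilde h\,d\mu_{\langle f\rangle}=2\mathcal E(fh,f)-\mathcal E(f^2,h)$ for all $h\in\mathcal F_b$ (so $\mathcal E(f,f)=\tfrac12\mu_{\langle f\rangle}(X)$). For $f\in\mathcal F^\bullet_{\mathrm{loc}}$, with $G_\bullet\in\mathscr G$ and $f_n\in\mathcal F_b$ such that $f=f_n$ $\mathfrak m$-a.e. on $G_n$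 for all $n$, $\mu_{\langle f\rangle}(B)=\lim_n\mu_{\langle f_n\rangle}(B\cap G_n)$, independently of the choices. A $\sigma$-finite Borel measure $\mu$ is $\mathcal E$-dominant if $\mu_{\langle f\rangle}\ll\mu$ for all $f\in\mathcal F$. Moderance. $\mathscr G_0$ is the set of $G_\bullet\in\mathscr G$ for which there are $e_n\in\mathcal F$ with $0\le e_n\le1$ and $e_n=1$ $\mathfrak m$-a.e. on $G_n$. A $\sigma$-finite Borel measure $\mu$ not charging $\mathcal E$-polar sets is $\mathcal E$-moderate if there are $G_\bullet\in\mathscr G_0$ and such $(e_n)$ with $\int\widetilde e_n\,d\mu<\infty$ for all $n$. Bounded energy and intrinsic distance. $\mathbb L^\mu_{\mathrm{loc}}=\{f\in\mathcal F^\bullet_{\mathrm{loc}}:\mu_{\langle f\rangle}\le\mu\}$; $\mathbb L^{\mu,\tau}_{\mathrm{loc},b}$ is the set of bounded $\tau$-continuous functions in $\mathbb L^\mu_{\mathrm{loc}}$; $\mathsf d_\mu(x,y)=\sup\{f(x)-f(y):f\in\mathbb L^{\mu,\tau}_{\mathrm{loc},b}\}$. Distances. An extended pseudo-distance $\mathsf d\colon X\times X\to[0,\infty]$ is symmetric, vanishes on the diagonal and satisfies the triangle inequality; a pseudo-distance is moreover finite. $\mathsf d(\cdot,A)=\inf_{y\in A}\mathsf d(\cdot,y)$ ($\inf\varnothing=+\infty$). A uniformity is a family of pseudo-distances closed under pairwise maxima and containing every pseudo-distance dominated by one of its members; $\mathsf d$ is $\tau$-admissible if $\mathsf d=\sup\{\mathsf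 d':\mathsf d'\in\mathscr U\}$ for some uniformity $\mathscr U$ of $\tau\times\tau$-continuous pseudo-distances. $\mathrm{Lip}^1(\mathsf d,\Sigma)$ is the set of $\Sigma$-measurable $\hat f\colon X\to\mathbb R$ with $|\hat f(x)-\hat f(y)|\le\mathsf d(x,y)$ for all $x,y$. Rademacher property of $(\mathbb X,\mathcal E,\mathsf d,\mu)$: every $\hat f\in\mathrm{Lip}^1(\mathsf d,\Sigma)$ whose $\mathfrak m$-class $f$ lies in $(L^\infty(\mathfrak m))^\bullet_{\mathrm{loc}}$ satisfies $f\in\mathbb L^\mu_{\mathrm{loc}}$. Sobolev-to-Lipschitz property (defined for $\mathcal E$-dominant $\mu$, so possessing it includes $\mathcal E$-dominance of $\mu$): every $f\in\mathbb L^\mu_{\mathrm{loc}}$ has an $\mathfrak m$-representative in $\mathrm{Lip}^1(\mathsf d,\Sigma)$. Maximal function. For $A\in\Sigma$, $\bar{\mathsf d}_{\mu,A}\colon X\to[0,\infty]$ is the $\mathfrak m$-a.e. unique $\Sigma$-measurable function such that, for every $r>0$, $\bar{\mathsf d}_{\mu,A}\wedge r$ is the $\mathfrak m$-a.e. maximal element of $\{f\in\mathbb L^\mu_{\mathrm{loc}}: f=0\ \mathfrak m\text{-a.e. on }A,\ |f|\le r\ \mathfrak m\text{-a.e.}\}$ (such a function exists). *)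

(* Defs.v *)
From HB Require Import structures.
From mathcomp Require Import all_boot all_order all_algebra.
From mathcomp Require Import all_classical all_reals all_analysis.
From mathcomp Require Import measurable_realfun.
Import numFieldNormedType.Exports.

Set Implicit Arguments.
Unset Strict Implicit.
Unset Printing Implicit Defensive.
Import Order.TTheory GRing.Theory Num.Theory.

Local Open Scope classical_set_scope.
Local Open Scope ring_scope.

(* The two measurable structures on a topological space X: its Borel sets and a
   bigger sigma-algebra Sigma. Both types are convertible to X. The sets that
   are measurable in [withSigma Sigma] are those of <<s Sigma>>, i.e. those of
   Sigma once Sigma is known to be a sigma-algebra. *)
Notation borelX X := (g_sigma_algebraType (@open X)).
Notation withSigma Sigma := (g_sigma_algebraType Sigma).

Section spaces.
Context {R : realType}.

Definition polish (P : metricType R) : Prop :=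
  (forall F : set_system P, ProperFilter F -> cauchy F ->
    exists p : P, F --> p) /\
  (exists2 D : set P, countable D & dense D).

Definition luzin (X : ptopologicalType) : Prop :=
  hausdorff_space X /\
  exists (P : metricType R) (phi : P -> X),
    [/\ polish P, continuous phi, injective phi & range phi = [set: X]].

Record luzin_measure_space (X : ptopologicalType) (Sigma : set (set X))
    (m : {measure set (withSigma Sigma) -> \bar R}) : Prop := {
  lms_luzin : luzin X;
  lms_sigma : sigma_algebra [set: X] Sigma;
  lms_borel : <<s @open X >> `<=` Sigma;
  lms_completion : forall A : set X, Sigma A ->
    exists B C : set X, [/\ <<s @open X >> B, <<s @open X >> C,
      B `<=` A, A `<=` C & m (C `\` B) = 0%E];
  lms_sigma_finite : sigma_finite [set: withSigma Sigma] m;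
  lms_full_support : forall U : set X, open U -> U !=set0 -> (0 < m U)%E
}.

End spaces.

Section dirichlet_forms.
Context {R : realType} {X : ptopologicalType} {Sigma : set (set X)}.
Variable m : {measure set (withSigma Sigma) -> \bar R}.
Implicit Types f g h u v : X -> R.

Definition Sigma_measurable f : Prop :=
  measurable_fun [set: withSigma Sigma] (f : withSigma Sigma -> R).

Definition L2 : set (X -> R) :=
  [set f | (f : withSigma Sigma -> R) \in Lfun m 2%:E].

Definition Linfty : set (X -> R) :=
  [set f | (f : withSigma Sigma -> R) \in Lfun m +oo%E].

Definition graph_norm_sq (dform : (X -> R) -> (X -> R) -> R) f : R :=
  dform f f + \int[m]_x (f x ^+ 2).

(* m-classes are handled through their Sigma-measurable representatives: the
   domain and the form are invariant under m-a.e. equality ([dom_ae] and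
   [form_ae]). Values of [dform] outside the domain are irrelevant. Closedness
   is completeness of the domain for the square root of [graph_norm_sq]. *)
Record dirichlet_form := DirichletForm {
  dom : set (X -> R);
  dform : (X -> R) -> (X -> R) -> R;
  dom_L2 : dom `<=` L2;
  dom_ae : forall f g, dom f -> Sigma_measurable g -> f = g %[ae m] -> dom g;
  form_ae : forall f g h, dom f -> dom g -> dom h ->
    f = g %[ae m] -> dform f h = dform g h;
  dom_lin : forall (a : R) f g, dom f -> dom g -> dom (a *: f + g);
  form_lin : forall (a : R) f g h, dom f -> dom g -> dom h ->
    dform (a *: f + g) h = a * dform f h + dform g h;
  form_sym : forall f g, dom f -> dom g -> dform f g = dform g f;
  form_ge0 : forall f, dom f -> 0 <= dform f f;
  dom_dense : forall f, L2 f -> forall e : R, 0 < e ->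
    exists2 g, dom g & (\int[m]_x ((f x - g x) ^+ 2)%:E < e%:E)%E;
  form_closed : forall u_ : nat -> X -> R, (forall n, dom (u_ n)) ->
    (forall e : R, 0 < e -> exists N : nat, forall i j : nat,
      (N <= i)%N -> (N <= j)%N -> graph_norm_sq dform (u_ i - u_ j) < e) ->
    exists2 u, dom u & graph_norm_sq dform (u_ n - u) @[n --> \oo] --> (0 : R);
  form_markov : forall f, dom f ->
    let f01 := fun x => Num.min (Num.max (f x) 0) 1 in
    dom f01 /\ dform f01 f01 <= dform f f
}.

Variable E : dirichlet_form.

Definition dense_in_dom (S : set (X -> R)) : Prop :=
  S `<=` dom E /\
  forall u, dom E u -> forall e : R, 0 < e ->
    exists2 v, S v & graph_norm_sq (dform E) (u - v) < e.

Definition dom_b : set (X -> R) := dom E `&` Linfty.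

Definition dom_on (A : set X) : set (X -> R) :=
  [set u | dom E u /\ \forall x \ae m, ~ A x -> u x = 0].

Definition nest (F : nat -> set X) : Prop :=
  [/\ forall n, closed (F n), forall n, F n `<=` F n.+1 &
      dense_in_dom (\bigcup_n dom_on (F n))].

Definition polar (N : set X) : Prop :=
  exists2 F : nat -> set X, nest F & N `<=` ~` \bigcup_n F n.

Definition quasi_open (G : set X) : Prop :=
  <<s @open X >> G /\
  exists2 F : nat -> set X, nest F &
    forall n, exists2 U : set X, open U & G `&` F n = U `&` F n.

Definition quasi_continuous f : Prop :=
  exists2 F : nat -> set X, nest F & forall n, {within F n, continuous f}.

Definition qc_representative f (ft : X -> R) : Prop :=
  quasi_continuous ft /\ ft = f %[ae m].

Definition borel_qc_representative f (ft : X -> R) : Prop :=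
  qc_representative f ft /\
  measurable_fun [set: borelX X] (ft : borelX X -> R).

Definition quasi_regular : Prop :=
  [/\ exists2 F : nat -> set X, nest F & forall n, compact (F n),
      exists2 S : set (X -> R), dense_in_dom S &
        forall u, S u -> exists ut, qc_representative u ut &
      exists (N : set X) (u ut : nat -> X -> R),
        [/\ polar N, forall n, dom E (u n),
            forall n, qc_representative (u n) (ut n) &
            forall x y, ~ N x -> ~ N y -> x <> y ->
              exists n, ut n x <> ut n y]].

(* Support of an m-class. *)
Definition supp f : set X :=
  \bigcap_(F in [set F : set X | closed F /\
    \forall x \ae m, ~ F x -> f x = 0]) F.

Definition strongly_local : Prop :=
  forall f g, dom E f -> dom E g -> compact (supp f) -> compact (supp g) ->
    (exists (c : R) (U : set X), [/\ open U, supp g `<=` U &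
      \forall x \ae m, U x -> f x = c]) ->
    dform E f g = 0.

Definition script_G (G : nat -> set X) : Prop :=
  [/\ forall n, quasi_open (G n), forall n, polar (G n `\` G n.+1) &
      polar (~` \bigcup_n G n)].

Definition loc (S : set (X -> R)) : set (X -> R) :=
  [set f | Sigma_measurable f /\
    exists (G : nat -> set X) (f_ : nat -> X -> R),
      [/\ script_G G, forall n, S (f_ n) &
          forall n, f = f_ n %[ae m in G n]]].

Definition not_charging_polar
    (nu : {measure set (borelX X) -> \bar R}) : Prop :=
  forall N : set X, <<s @open X >> N -> polar N -> nu N = 0%E.

Definition is_energy_measure_b f
    (nu : {measure set (borelX X) -> \bar R}) : Prop :=
  [/\ (nu [set: X] < +oo)%E, not_charging_polar nu &
      forall h ht, dom_b h -> borel_qc_representative h ht ->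
        (\int[nu]_x (ht x)%:E =
          (2 * dform E (f * h) f - dform E (f * f) h)%:E)%E].

Definition is_energy_measure f
    (nu : {measure set (borelX X) -> \bar R}) : Prop :=
  exists (G : nat -> set X) (f_ : nat -> X -> R)
      (nu_ : nat -> {measure set (borelX X) -> \bar R}),
    [/\ script_G G, forall n, dom_b (f_ n),
        forall n, f = f_ n %[ae m in G n],
        forall n, is_energy_measure_b (f_ n) (nu_ n) &
        forall B : set X, <<s @open X >> B ->
          nu_ n (B `&` G n) @[n --> \oo] --> nu B].

(* Definite description; on a quasi-regular strongly local space the measure
   exists and is unique for every f in loc (dom E). *)
Definition energy_measure f : {measure set (borelX X) -> \bar R} :=
  xget (mzero : {classic {measure set (borelX X) -> \bar R}})
    [set nu | is_energy_measure f nu].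

Definition dominant (mu : {measure set (borelX X) -> \bar R}) : Prop :=
  forall f, dom E f -> energy_measure f `<< mu.

(* Two quasi-continuous representatives agree q.e., so the finiteness of the
   integral does not depend on the representative when mu does not charge
   polar sets. *)
Definition moderate (mu : {measure set (borelX X) -> \bar R}) : Prop :=
  exists (G : nat -> set X) (e et : nat -> X -> R),
    script_G G /\
    forall n, [/\ dom E (e n), \forall x \ae m, 0 <= e n x <= 1,
      e n = cst 1 %[ae m in G n], borel_qc_representative (e n) (et n) &
      (\int[mu]_x (et n x)%:E < +oo)%E].

Section reference_measure.
Variable mu : {measure set (borelX X) -> \bar R}.

Definition Lmu_loc : set (X -> R) :=
  [set f | loc (dom E) f /\
    forall B : set X, <<s @open X >> B -> (energy_measure f B <= mu B)%E].

Definition Lmu_tau_loc_b : set (X -> R) :=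
  [set f | [/\ Lmu_loc f, continuous f &
    exists M : R, forall x, `|f x| <= M]].

Definition intrinsic_dist (x y : X) : \bar R :=
  ereal_sup [set (f x - f y)%:E | f in Lmu_tau_loc_b].

Definition maximal_competitor (A : set X) (r : R) : set (X -> R) :=
  [set f | [/\ Lmu_loc f, \forall x \ae m, A x -> f x = 0 &
    \forall x \ae m, `|f x| <= r]].

Definition is_maximal_function (A : set X) (rho : X -> \bar R) : Prop :=
  [/\ measurable_fun [set: withSigma Sigma] (rho : withSigma Sigma -> \bar R),
      forall x, (0 <= rho x)%E &
      forall r : R, 0 < r ->
        let rho_r := fun x => fine (mine (rho x) r%:E) in
        maximal_competitor A r rho_r /\
        forall f, maximal_competitor A r f ->
          \forall x \ae m, f x <= rho_r x].

(* Definite description, up to m-a.e. equality. *)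
Definition maximal_function (A : set X) : X -> \bar R :=
  xget (cst 0%E) [set rho | is_maximal_function A rho].

End reference_measure.

End dirichlet_forms.

Section distances.
Context {R : realType} {X : ptopologicalType}.
Implicit Types d : X -> X -> \bar R.

Definition extended_pseudo_distance d : Prop :=
  [/\ forall x y, (0 <= d x y)%E, forall x, d x x = 0%E,
      forall x y, d x y = d y x &
      forall x y z, (d x z <= d x y + d y z)%E].

Definition pseudo_distance (d : X -> X -> R) : Prop :=
  extended_pseudo_distance (fun x y => (d x y)%:E).

Definition dist_to d (A : set X) (x : X) : \bar R :=
  ereal_inf [set d x y | y in A].

Definition uniformity (U : set (X -> X -> R)) : Prop :=
  [/\ U `<=` pseudo_distance,
      forall p1 p2, U p1 -> U p2 ->
        U (fun x y => Num.max (p1 x y) (p2 x y)) &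
      forall p1 p2, pseudo_distance p1 -> U p2 ->
        (forall x y, p1 x y <= p2 x y) -> U p1].

Definition admissible d : Prop :=
  exists U : set (X -> X -> R),
    [/\ uniformity U,
        forall p, U p -> continuous (fun z : X * X => p z.1 z.2) &
        forall x y, d x y = ereal_sup [set (p x y)%:E | p in U]].

Definition Lip1 (Sigma : set (set X)) d : set (X -> R) :=
  [set f | measurable_fun [set: withSigma Sigma] (f : withSigma Sigma -> R) /\
    forall x y, (`|f x - f y|%:E <= d x y)%E].

Definition rademacher (Sigma : set (set X))
    (m : {measure set (withSigma Sigma) -> \bar R}) (E : dirichlet_form m)
    d (mu : {measure set (borelX X) -> \bar R}) : Prop :=
  forall f, Lip1 Sigma d f -> loc E (Linfty m) f -> Lmu_loc E mu f.

Definition sobolev_to_lipschitz (Sigma : set (set X))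
    (m : {measure set (withSigma Sigma) -> \bar R}) (E : dirichlet_form m)
    d (mu : {measure set (borelX X) -> \bar R}) : Prop :=
  dominant E mu /\
  forall f, Lmu_loc E mu f ->
    exists2 fh, Lip1 Sigma d fh & fh = f %[ae m].

End distances.

(* Main.v *)
Require Import Defs.
From mathcomp Require Import all_boot all_order all_algebra.
From mathcomp Require Import all_classical all_reals all_analysis.
From mathcomp Require Import measurable_realfun ess_sup_inf lra.
Import numFieldNormedType.Exports.
Import Order.TTheory GRing.Theory Num.Theory.
Local Open Scope classical_set_scope.
Local Open Scope ring_scope.

(** Under the Rademacher and Sobolev-to-Lipschitz properties the energy measures
disappear from the problem: a bounded function belongs to [Lmu_loc] whenever it
is in [Lip1] ([Lip1_bounded_Lmu_loc], with the constant exhaustion by the whole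
space), and conversely every member of [Lmu_loc] agrees a.e. with a member of
[Lip1]. Up to a.e. equality, the competitors for the maximal function of A are
thus the bounded d-Lipschitz functions vanishing a.e. on A.

The only obstruction to comparing such a function with the distance from A is
that it vanishes on A merely a.e., with an exceptional set depending on the
function. For each natural number k, the family of functions in [Lip1] with
values in [0, k] that vanish a.e. on A is closed under countable suprema, so
that, m being sigma-finite, it contains an a.e. greatest element h_k
([essential_greatest]).
The points of A where some h_k does not vanish form a null set; let At be the
set of the other points of A. Then h_k <= d(., At) everywhere, so every
competitor is a.e. below d(., At). Conversely the truncations of d(., At) are
themselves competitors, because they are Lipschitz. Hence d(., At) is a maximal
function both for A and for At ([is_maximal_function_dist_to]), and maximal
functions are a.e. unique ([is_maximal_function_unique]).

As for the intrinsic distance, d <= d_mu holds everywhere: d is a supremum of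
continuous pseudo-distances p, and the truncations of p(., y) are bounded
continuous and Lipschitz ([le_intrinsic_dist]). The converse inequality holds
off a null set N, i.e. for x and y both outside N ([intrinsic_dist_le_ae]): in a
Luzin space the supremum defining d_mu is reached along countably many
continuous functions ([luzin_countable_increments]), each of which agrees a.e.
with a d-Lipschitz function. Removing N from At as well gives
d(., At) = d_mu(., At) off N. *)

(** * Essential maxima *)

(** A non-empty family of functions with values in [0, r] which is closed under
countable suprema has an a.e. greatest member. On each piece of finite measure
the supremum of the integrals over the family is attained, and one function
attains it on all the pieces. *)
Lemma essential_greatest {d} {T : measurableType d} {R : realType}
    (m : {measure set T -> \bar R}) (r : R) (C : set (T -> R)) :
  sigma_finite [set: T] m ->
  (forall f, C f -> measurable_fun [set: T] f) ->
  (forall f x, C f -> 0 <= f x <= r) ->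
  C !=set0 ->
  (forall f_ : nat -> T -> R, (forall n, C (f_ n)) ->
    C (fun x => sup (range (f_ ^~ x)))) ->
  exists2 h, C h & forall f, C f -> \forall x \ae m, f x <= h x.
Proof.
move=> [S Scover Sfin] Cmeas Cbnd [f0 Cf0] Csup.
have sup_ge (f_ : nat -> T -> R) (n : nat) (x : T) :
    (forall n, C (f_ n)) -> f_ n x <= sup (range (f_ ^~ x)).
  move=> Cf; apply: ub_le_sup; last by exists n.
  by exists r => _ [k _ <-]; case/andP: (Cbnd _ x (Cf k)).
pose I j f := (\int[m]_(x in S j) (f x)%:E)%E.
have mS j : measurable (S j) by case: (Sfin j).
have CmeasE j f : C f -> measurable_fun (S j) (EFin \o f).
  move=> Cf; apply/measurable_EFinP; apply: measurable_funTS; exact: Cmeas.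
have Cge0 j f x : C f -> S j x -> (0 <= (f x)%:E)%E.
  by move=> Cf _; rewrite lee_fin; case/andP: (Cbnd _ x Cf).
have leI j f g : C f -> C g -> (forall x, f x <= g x) -> (I j f <= I j g)%E.
  move=> Cf Cg fg; apply: ge0_le_integral => //.
  - by move=> x; exact: Cge0.
  - exact: CmeasE.
  - exact: CmeasE.
  - by move=> x _; rewrite lee_fin.
have I_ge0 j f : C f -> (0 <= I j f)%E.
  by move=> Cf; apply: integral_ge0 => x; exact: Cge0.
have I_ub j f : C f -> (I j f <= r%:E * m (S j))%E.
  move=> Cf; rewrite -integral_cst//; apply: ge0_le_integral => //.
  - by move=> x; exact: Cge0.
  - exact: CmeasE.
  - by move=> x _; rewrite lee_fin; case/andP: (Cbnd _ x Cf).
pose s j := ereal_sup [set I j f | f in C].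
have I_le_s j f : C f -> (I j f <= s j)%E.
  by move=> Cf; apply: ereal_sup_ubound; exists f.
have s_fin j : s j \is a fin_num.
  rewrite ge0_fin_numE; last exact: le_trans (I_ge0 _ _ Cf0) (I_le_s _ _ Cf0).
  apply: (@le_lt_trans _ _ (r%:E * m (S j))%E).
    by apply: ge_ereal_sup => _ [f Cf <-]; exact: I_ub.
  have [_ mSj] := Sfin j.
  have mfin : m (S j) \is a fin_num by rewrite ge0_fin_numE.
  by rewrite -(fineK mfin) -EFinM ltry.
(* The supremum of a maximizing sequence attains s j. *)
have attained j : exists2 g, C g & I j g = s j.
  have /choice[f_ f_P] : forall n : nat, exists f,
      C f /\ (s j - (n.+1%:R^-1)%:E < I j f)%E.
    move=> n; have [|_ [f Cf <-] fs] :=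
      @ub_ereal_sup_adherent _ [set I j f | f in C] (n.+1%:R^-1) _ (s_fin j).
      by rewrite invr_gt0 ltr0n.
    by exists f.
  have Cf_ n : C (f_ n) by case: (f_P n).
  exists (fun x => sup (range (f_ ^~ x))); first exact: Csup.
  apply/eqP; rewrite eq_le I_le_s ?andTb; last exact: Csup.
  apply/lee_addgt0Pr => e e0.
  have [n ne] : exists n : nat, n.+1%:R^-1 < e.
    have [N _ /(_ N (leqnn N))] := near_infty_natSinv_lt (PosNum e0).
    by exists N.
  rewrite -leeBlDr//.
  apply: (@le_trans _ _ (I j (f_ n))); last first.
    by apply: leI => // [|x]; [exact: Csup|exact: sup_ge].
  apply: ltW; apply: le_lt_trans (f_P n).2.
  by rewrite leeB// lee_fin ltW.
have /choice[g_ g_P] : forall j, exists g, C g /\ I j g = s j.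
  by move=> j; have [g Cg gs] := attained j; exists g.
have Cg_ j : C (g_ j) by case: (g_P j).
pose h x := sup (range (g_ ^~ x)).
have Ch : C h by exact: Csup.
have Ih j : I j h = s j.
  apply/eqP; rewrite eq_le I_le_s//= -(g_P j).2.
  by apply: leI => // x; exact: sup_ge.
exists h => // f Cf.
(* k is the maximum of f and h, written as a countable supremum. *)
pose k_ n := if n is 0%N then f else h.
have Ck_ n : C (k_ n) by case: n.
pose k x := sup (range (k_ ^~ x)).
have Ck : C k by exact: Csup.
have fk x : f x <= k x by exact: (sup_ge k_ 0%N).
have hk x : h x <= k x by exact: (sup_ge k_ 1%N).
(* As h <= k have the same finite integral s j on S j, they agree there. *)
have kh j : \forall x \ae m, S j x -> (k x - h x)%:E = 0%E.
  have mkh : measurable_fun (S j) (fun x => (k x - h x)%:E).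
    apply/measurable_EFinP; apply: measurable_funB.
    - by apply: measurable_funTS; exact: Cmeas.
    - by apply: measurable_funTS; exact: Cmeas.
  have kh0 x : (0 <= (k x - h x)%:E)%E by rewrite lee_fin subr_ge0.
  apply/(ae_eq_integral_abs m (mS j) mkh).
  under eq_integral do rewrite gee0_abs//.
  have : I j k = (I j h + \int[m]_(x in S j) (k x - h x)%:E)%E.
    rewrite /I -ge0_integralD//; last 2 first.
    - by move=> x; exact: Cge0.
    - exact: CmeasE.
    by apply: eq_integral => x _; rewrite -EFinD addrC subrK.
  have -> : I j k = s j.
    by apply/eqP; rewrite eq_le I_le_s//= -(Ih j); exact: leI.
  rewrite Ih => sE; apply/eqP; rewrite eq_le integral_ge0// andbT.
  by rewrite -(@leeD2lE _ (s j))// adde0 -sE.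
have : \forall x \ae m, forall j, S j x -> (k x - h x)%:E = 0%E.
  exact: ae_foralln.
apply: filterS => x khx.
have [j _ Sjx] : (\bigcup_j S j) x by rewrite -Scover.
by have [/subr0_eq <-] := khx j Sjx.
Qed.

(** * Countable families of continuous functions on Luzin spaces *)

(** In a Luzin space, countably many members of a family of continuous
functions have the same supremum of increments as the whole family. The family
is pulled back to a separable metric space; for each pair of balls of a
countable base and each rational bound, one member whose increments between
the two balls all exceed the bound is selected, when there is one. *)
Lemma luzin_countable_increments {R : realType} (X : ptopologicalType)
    (F : set (X -> R)) :
  luzin (R := R) X -> F !=set0 -> (forall f, F f -> continuous f) ->
  exists2 f_ : nat -> X -> R, (forall n, F (f_ n)) &
    forall f x y q, F f -> q < f x - f y -> exists n, q < f_ n x - f_ n y.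
Proof.
move=> [_ [P [phi [[_ [D Dcount Ddense]] phic _ phisurj]]]] [f0 Ff0] Fc.
have phiP x : exists u, phi u = x.
  have [u _ <-] : range phi x by rewrite phisurj.
  by exists u.
have [p Dp] : exists p : nat -> P, D `<=` range p.
  have [u0 _] := phiP point.
  have [u1 [_ Du1]] := Ddense setT (ex_intro _ u0 I) openT.
  case/pfcard_geP: Dcount => [D0|[p]]; first by rewrite D0 in Du1.
  by exists p => u /(@surj _ _ _ _ p)[n _ <-]; exists n.
pose rad k : R := k.+1%:R^-1.
pose good (i : nat * nat * nat * rat) := [set g | F g /\
  forall u v, ball (p i.1.1.1) (rad i.1.2) u ->
    ball (p i.1.1.2) (rad i.1.2) v -> ratr i.2 < g (phi u) - g (phi v)].
pose f_ n := if unpickle n is Some i then xget f0 (good i) else f0.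
exists f_ => [n|f x y q Ff].
  by rewrite /f_; case: unpickle => // i; case: xgetP => [g _ []|].
have [u0 <-] := phiP x; have [v0 <-] := phiP y => /rat_in_itvoo[s].
rewrite in_itv/= => /andP[qs sf].
(* Moving each endpoint by less than e keeps the increment above ratr s. *)
pose e := (f (phi u0) - f (phi v0) - ratr s) / 2.
have e0 : 0 < e by rewrite divr_gt0// subr_gt0.
have near_f w0 : exists2 dl : R, 0 < dl & forall w, ball w0 dl w ->
    `|f (phi w0) - f (phi w)| < e.
  have cf : {for w0, continuous (f \o phi)}.
    by apply: continuous_comp; [exact: phic|exact: Fc].
  have : nbhs w0 (fun w => `|f (phi w0) - f (phi w)| < e).
    exact: (cvgr_dist_lt _ _ cf).
  by move=> /nbhs_ballP[dl dl0 dlP]; exists dl.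
have [du du0 duP] := near_f u0; have [dv dv0 dvP] := near_f v0.
have [k ku kv] : exists2 k, rad k + rad k < du & rad k + rad k < dv.
  have h0 : 0 < Num.min du dv / 2 by rewrite divr_gt0// lt_min du0.
  have [k _ /(_ k (leqnn k))/=] := near_infty_natSinv_lt (PosNum h0).
  rewrite /= => kh; exists k; rewrite /rad.
    by apply: lt_le_trans (ltrD kh kh) _; rewrite -splitr ge_min lexx.
  by apply: lt_le_trans (ltrD kh kh) _; rewrite -splitr ge_min lexx orbT.
have rad0 : 0 < rad k by rewrite invr_gt0 ltr0n.
have near_p w0 : exists a, ball w0 (rad k) (p a).
  have [|w [wb /Dp[a _ pa]]] := Ddense (ball w0 (rad k))^° _ (open_interior _).
    by exists w0; exact: nbhsx_ballx.
  by exists a; rewrite pa; exact: interior_subset wb.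
have [a ua] := near_p u0; have [b vb] := near_p v0.
exists (pickle (a, b, k, s)); rewrite /f_ pickleK.
have [|_ gP] := @xgetPex _ f0 (good (a, b, k, s)).
  exists f; split=> // u v /= bu bv.
  have /duP fu : ball u0 du u.
    by apply: le_ball (ltW ku) _ _; exact: ball_triangle ua bu.
  have /dvP fv : ball v0 dv v.
    by apply: le_ball (ltW kv) _ _; exact: ball_triangle vb bv.
  have : f (phi u0) - f (phi v0) - ratr s = e + e by rewrite -splitr.
  move: fu fv; rewrite !ltr_norml => /andP[_ ?] /andP[? _] ?.
  lra.
apply: lt_trans qs _; apply: gP => /=; exact: ball_sym.
Qed.

(** * Bounded functions in the broad local space *)

Lemma script_G_setT {R : realType} {X : ptopologicalType}
    {Sigma : set (set X)} {m : {measure set (withSigma Sigma) -> \bar R}}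
    (E : dirichlet_form m) : quasi_regular E -> script_G E (fun=> [set: X]).
Proof.
move=> [[F nestF _] _ _].
have polar0 N : N = set0 -> polar E N by move=> ->; exists F.
split; last 2 first.
- by move=> n; apply: polar0; rewrite setDv.
- by apply: polar0; rewrite bigcup_const ?setCT//; exists 0%N.
move=> n; split; first by apply: sub_sigma_algebra; exact: openT.
by exists F => // k; exists setT => //; exact: openT.
Qed.

Lemma loc_Linfty_bounded {R : realType} {X : ptopologicalType}
    {Sigma : set (set X)} {m : {measure set (withSigma Sigma) -> \bar R}}
    (E : dirichlet_form m) (f : X -> R) (M : R) :
  quasi_regular E -> Sigma_measurable (Sigma := Sigma) f ->
  (forall x, `|f x| <= M) -> loc E (Linfty m) f.
Proof.
move=> qrE mf fM; split=> //.
exists (fun=> setT), (fun=> f); split=> [|n|n]; first exact: script_G_setT.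
- rewrite /Linfty/= inE; apply/andP; split; rewrite inE//=.
  rewrite /finite_norm unlock /=; case: ifP => // _.
  apply: (@le_lt_trans _ _ M%:E); last by rewrite ltry.
  by apply/ess_supP; apply: nearW => x /=; rewrite lee_fin.
- exact: nearW.
Qed.

(** * Lipschitz functions for an extended pseudo-distance *)

(** The one-sided form of the Lipschitz condition passes to suprema and infima,
also where d is infinite. *)
Lemma lip_leP {R : realType} {X : ptopologicalType} (d : X -> X -> \bar R)
    (f : X -> R) : extended_pseudo_distance d ->
  (forall x y, (`|f x - f y|%:E <= d x y)%E) <->
  (forall x y, ((f x)%:E <= (f y)%:E + d x y)%E).
Proof.
move=> [d0 _ dC _]; split=> fd x y.
  apply: (@le_trans _ _ ((f y)%:E + `|f x - f y|%:E)%E); last by rewrite leeD2l.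
  by rewrite -EFinD lee_fin -lerBlDl ler_norm.
have := fd x y; have := fd y x; rewrite (dC y x).
case: (d x y) (d0 x y) => [r||]// _; last first.
  by move=> _ _; rewrite leey.
by rewrite -!EFinD !lee_fin ler_norml => ? ?; apply/andP; split; lra.
Qed.

Lemma Lip1_clip {R : realType} {X : ptopologicalType} {Sigma : set (set X)}
    (d : X -> X -> \bar R) (f : X -> R) (r : R) :
  Lip1 Sigma d f -> Lip1 Sigma d (fun x => Num.min (Num.max (f x) 0) r).
Proof.
move=> [mf fd]; split.
  apply: (@measurable_minr _ (withSigma Sigma) R setT
    (fun x => Num.max (f x) 0) (cst r)) => //.
  exact: (@measurable_maxr _ (withSigma Sigma) R setT f (cst 0)).
move=> x y; apply: le_trans (fd x y); rewrite lee_fin.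
have h1 := ler_norm (f x - f y); have h2 := ler_norm (f y - f x).
rewrite distrC in h2; rewrite ler_norml.
case: (lerP (f x) 0) => fx0; case: (lerP (f y) 0) => fy0;
  case: (lerP (f x) r) => ?; case: (lerP (f y) r) => ?;
  case: (lerP 0 r) => ?; apply/andP; split; lra.
Qed.

Lemma Lip1_sup {R : realType} {X : ptopologicalType} {Sigma : set (set X)}
    (d : X -> X -> \bar R) (f_ : nat -> X -> R) :
  extended_pseudo_distance d -> (forall n, Lip1 Sigma d (f_ n)) ->
  (forall x, has_ubound (range (f_ ^~ x))) ->
  Lip1 Sigma d (fun x => sup (range (f_ ^~ x))).
Proof.
move=> dd lipf ubf; split.
  have -> : (fun x => sup (range (f_ ^~ x))) = (fun x => sups (f_ ^~ x) 0%N).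
    apply/funext => x; rewrite /sups /sdrop; congr sup.
    by apply/seteqP; split=> _ [n _ <-]; exists n.
  by apply: measurable_fun_sups => [//|n]; case: (lipf n).
apply/lip_leP => // x y.
have [d0 _ _ _] := dd; case dxy: (d x y) (d0 x y) => [D||]// _; last first.
  by rewrite addey// leey.
rewrite -EFinD lee_fin; apply: ge_sup => [|_ [n _ <-]].
  by exists (f_ 0%N x), 0%N.
have := (lip_leP d (f_ n) dd).1 (lipf n).2 x y.
rewrite dxy -EFinD lee_fin => /le_trans; apply; rewrite lerD2r.
by apply: ub_le_sup => //; exists n.
Qed.

Lemma dist_to_ge0 {R : realType} {X : ptopologicalType}
    (d : X -> X -> \bar R) (B : set X) x :
  extended_pseudo_distance d -> (0 <= dist_to d B x)%E.
Proof.
by move=> [d0 _ _ _]; apply: le_ereal_inf_tmp => _ [y _ <-]; exact: d0.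
Qed.

Lemma dist_to_eq0 {R : realType} {X : ptopologicalType}
    (d : X -> X -> \bar R) (B : set X) x :
  extended_pseudo_distance d -> B x -> dist_to d B x = 0%E.
Proof.
move=> dd Bx; apply/eqP; rewrite eq_le dist_to_ge0// andbT.
have [_ dxx _ _] := dd; rewrite -(dxx x).
by apply: ereal_inf_lbound; exists x.
Qed.

Lemma dist_to_lip {R : realType} {X : ptopologicalType}
    (d : X -> X -> \bar R) (B : set X) x y :
  extended_pseudo_distance d ->
  (dist_to d B x <= dist_to d B y + d x y)%E.
Proof.
move=> dd; have [d0 _ dC dT] := dd.
case dxy: (d x y) (d0 x y) => [D||]// _; last first.
  rewrite addey ?leey// gt_eqF//; apply: lt_le_trans (dist_to_ge0 d B y dd).
  exact: ltNy0.
rewrite -leeBlDr//; apply: le_ereal_inf_tmp => _ [z Bz <-].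
rewrite leeBlDr// -dxy addeC; apply: le_trans (dT x y z).
by apply: ereal_inf_lbound; exists z.
Qed.

Lemma Lip1_dist_to {R : realType} {X : ptopologicalType} {Sigma : set (set X)}
    (d : X -> X -> \bar R) (B : set X) (r : R) :
  extended_pseudo_distance d -> 0 <= r ->
  measurable_fun [set: withSigma Sigma]
    (dist_to d B : withSigma Sigma -> \bar R) ->
  Lip1 Sigma d (fun x => fine (mine (dist_to d B x) r%:E)).
Proof.
move=> dd r0 mB; split.
  apply: measurableT_comp; first exact: fine_measurable.
  exact: measurable_mine.
apply/lip_leP => // x y.
have [d0 _ _ _] := dd.
have fin z : mine (dist_to d B z) r%:E \is a fin_num.
  rewrite ge0_fin_numE ?le_min ?dist_to_ge0//.
  by rewrite gt_min ltry orbT.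
rewrite !fineK//; have := dist_to_lip d B x y dd.
have := d0 x y; have := dist_to_ge0 d B y dd.
rewrite /mine; case: ifPn; case: ifPn; rewrite -?leNgt => yr xr By dxy le_xy //.
- by apply: le_trans (ltW xr) _; rewrite leeDl.
- exact: le_trans xr le_xy.
- by rewrite leeDl.
Qed.

Lemma Lip1_bounded_Lmu_loc {R : realType} {X : ptopologicalType}
    {Sigma : set (set X)} {m : {measure set (withSigma Sigma) -> \bar R}}
    (E : dirichlet_form m) (d : X -> X -> \bar R)
    (mu : {measure set (borelX X) -> \bar R}) (f : X -> R) (M : R) :
  quasi_regular E -> rademacher E d mu -> Lip1 Sigma d f ->
  (forall x, `|f x| <= M) -> Lmu_loc E mu f.
Proof.
move=> qrE rad lipf fM; apply: rad => //.
by apply: loc_Linfty_bounded fM => //; case: lipf.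
Qed.

(** * Maximal functions *)

Lemma is_maximal_function_unique {R : realType} {X : ptopologicalType}
    {Sigma : set (set X)} {m : {measure set (withSigma Sigma) -> \bar R}}
    (E : dirichlet_form m) (mu : {measure set (borelX X) -> \bar R})
    (A : set X) (rho1 rho2 : X -> \bar R) :
  is_maximal_function E mu A rho1 -> is_maximal_function E mu A rho2 ->
  rho1 = rho2 %[ae m].
Proof.
have aeF : Filter (nbhs (almost_everywhere m)) := ae_filter_ringOfSetsType m.
move=> [_ ge1 max1] [_ ge2 max2].
have eq_trunc (k : nat) : \forall x \ae m,
    fine (mine (rho1 x) k.+1%:R%:E) = fine (mine (rho2 x) k.+1%:R%:E).
  have k0 : 0 < k.+1%:R :> R by rewrite ltr0n.
  have [c1 m1] := max1 _ k0; have [c2 m2] := max2 _ k0.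
  move: (m1 _ c2) (m2 _ c1); apply: filterS2 => x le21 le12.
  by apply/eqP; rewrite eq_le le12 le21.
move: (ae_foralln eq_trunc); apply: filterS => x eqx _.
have le_trunc (a b : \bar R) : (0 <= a)%E -> (0 <= b)%E ->
    (forall k : nat, fine (mine a k.+1%:R%:E) = fine (mine b k.+1%:R%:E)) ->
    (a <= b)%E.
  move=> a0 b0 ab; rewrite leNgt; apply/negP => ba.
  have finm (c : \bar R) (k : nat) : (0 <= c)%E ->
      mine c k.+1%:R%:E \is a fin_num.
    move=> c0; rewrite ge0_fin_numE ?le_min ?c0 ?lee_fin ?ler0n//.
    by rewrite gt_min ltry orbT.
  have bfin : b \is a fin_num.
    by rewrite ge0_fin_numE//; apply: lt_le_trans ba (leey _).
  pose k := Num.truncn (fine b).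
  have bk : (b < k.+1%:R%:E)%E by rewrite -(fineK bfin) lte_fin truncnS_gt.
  have : mine a k.+1%:R%:E = mine b k.+1%:R%:E.
    by rewrite -(fineK (finm a k a0)) -(fineK (finm b k b0)) ab.
  rewrite [RHS]min_l ?ltW// => ab'.
  have : (b < mine a k.+1%:R%:E)%E by rewrite lt_min ba bk.
  by rewrite ab' ltxx.
by apply/eqP; rewrite eq_le; apply/andP; split; exact: le_trunc.
Qed.

(** The definite description defining [maximal_function] is met, up to a.e.
equality, by any maximal function that can be exhibited. *)
Lemma maximal_functionP {R : realType} {X : ptopologicalType}
    {Sigma : set (set X)} {m : {measure set (withSigma Sigma) -> \bar R}}
    (E : dirichlet_form m) (mu : {measure set (borelX X) -> \bar R})
    (A : set X) (rho : X -> \bar R) :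
  is_maximal_function E mu A rho -> maximal_function E mu A = rho %[ae m].
Proof.
move=> rhoP; apply: (is_maximal_function_unique _ _ _ _ _ _ rhoP).
apply: (@xgetPex _ _ [set rho' | is_maximal_function E mu A rho']).
by exists rho.
Qed.

(** Let B be a subset of A of full measure in A. If the bounded nonnegative
Lipschitz functions vanishing a.e. on B are a.e. below the distance from B, then
this distance is a maximal function for A; with A = B, it is one for B too. *)
Lemma is_maximal_function_dist_to {R : realType} {X : ptopologicalType}
    {Sigma : set (set X)} {m : {measure set (withSigma Sigma) -> \bar R}}
    (E : dirichlet_form m) (d : X -> X -> \bar R)
    (mu : {measure set (borelX X) -> \bar R}) (A B : set X) :
  quasi_regular E -> extended_pseudo_distance d ->
  rademacher E d mu -> sobolev_to_lipschitz E d mu ->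
  measurable_fun [set: withSigma Sigma]
    (dist_to d B : withSigma Sigma -> \bar R) ->
  B `<=` A -> m.-negligible (A `\` B : set (withSigma Sigma)) ->
  (forall f (r : R), Lip1 Sigma d f -> (forall x, 0 <= f x <= r) ->
    (\forall x \ae m, B x -> f x = 0) ->
    \forall x \ae m, ((f x)%:E <= dist_to d B x)%E) ->
  is_maximal_function E mu A (dist_to d B).
Proof.
move=> qrE dd rad [_ s2l] mB BA AB0 maxB.
have aeF : Filter (nbhs (almost_everywhere m)) := ae_filter_ringOfSetsType m.
split=> [//|x|r r0 rho_r]; first exact: dist_to_ge0.
have rho_r_bnd x : 0 <= rho_r x <= r.
  have := dist_to_ge0 d B x dd; rewrite /rho_r.
  case: (dist_to d B x) => [s||]//=; last by rewrite lexx (ltW r0).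
  by rewrite -EFin_min/= lee_fin le_min ge_min lexx orbT (ltW r0) => ->.
have rho_r_norm x : `|rho_r x| <= r.
  by case/andP: (rho_r_bnd x) => ? ?; rewrite ger0_norm.
split.
  split.
  - apply: (Lip1_bounded_Lmu_loc _ d _ _ r) => //.
    by apply: Lip1_dist_to => //; exact: ltW.
  - apply: negligibleS AB0 => x /= /not_implyP[Ax rhox]; split=> // Bx.
    by apply: rhox; rewrite /rho_r dist_to_eq0//= min_l// lee_fin ltW.
  - exact: nearW.
move=> f [Lf fA fr]; have [fh lipfh fhf] := s2l _ Lf.
(* The Lipschitz representative is only a.e. below r; clipping it to [0, r]
   keeps it Lipschitz and can only increase it where it is at most r. *)
pose g x := Num.min (Num.max (fh x) 0) r.
have g_bnd x : 0 <= g x <= r.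
  by rewrite /g le_min ge_min le_max !lexx !orbT (ltW r0).
have gB : \forall x \ae m, B x -> g x = 0.
  move: fhf fA; apply: filterS2 => x /(_ I) fhx fA Bx.
  by rewrite /g fhx (fA (BA _ Bx)) max_l// min_l// ltW.
move: fhf fr (maxB g r (Lip1_clip d fh r lipfh) g_bnd gB).
apply: filterS3 => x /(_ I) fhx frx gx.
have fg : f x <= g x.
  by rewrite /g fhx le_min le_max lexx/= (le_trans (ler_norm _)).
apply: le_trans fg _; have [_ gr] := andP (g_bnd x).
rewrite -lee_fin fineK; first by rewrite le_min gx lee_fin.
rewrite ge0_fin_numE ?le_min ?dist_to_ge0 ?lee_fin ?ltW//.
by rewrite gt_min ltry orbT.
Qed.

(** * Comparison with the intrinsic distance *)

Lemma continuous_Sigma_measurable {R : realType} {X : ptopologicalType}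
    {Sigma : set (set X)} (f : X -> R) :
  <<s @open X >> `<=` Sigma -> continuous f ->
  measurable_fun [set: withSigma Sigma] (f : withSigma Sigma -> R).
Proof.
move=> borelSigma /continuousP cf.
apply: (measurability _ (RGenOpens.measurableE R)).
move=> _ [_ [a [b ->]] <-]; rewrite setTI.
apply: (@sub_sigma_algebra _ [set: X] Sigma).
apply/borelSigma; apply: sub_sigma_algebra; apply: cf; exact: interval_open.
Qed.

Lemma le_intrinsic_dist {R : realType} {X : ptopologicalType}
    {Sigma : set (set X)} {m : {measure set (withSigma Sigma) -> \bar R}}
    (E : dirichlet_form m) (d : X -> X -> \bar R)
    (mu : {measure set (borelX X) -> \bar R}) x y :
  <<s @open X >> `<=` Sigma -> quasi_regular E -> rademacher E d mu ->
  extended_pseudo_distance d -> admissible d ->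
  (d x y <= intrinsic_dist E mu x y)%E.
Proof.
move=> borelSigma qrE rad dd [U [[Upd _ _] Ucont dU]].
rewrite dU; apply: ge_ereal_sup => _ [p Up <-].
have [p0 pxx pC pT] := Upd p Up; pose r := p x y.
have r0 : 0 <= r by rewrite -lee_fin; exact: p0.
(* The test function p(., y), truncated at its value at x. *)
pose g z := Num.min (p z y) r.
have gbnd z : `|g z| <= r.
  have pz0 : 0 <= p z y by rewrite -lee_fin; exact: p0.
  by rewrite ger0_norm /g ?ge_min ?le_min ?lexx ?orbT ?pz0.
have gcont : continuous g.
  move=> z; apply: continuous_min; last exact: cst_continuous.
  apply: (@continuous_comp _ _ _ (fun z => (z, y)) (fun z => p z.1 z.2)).
    by apply: cvg_pair => /=; [exact: cvg_id|exact: cvg_cst].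
  exact: Ucont.
have lipg : Lip1 Sigma d g.
  split; first exact: continuous_Sigma_measurable.
  apply/lip_leP => // u v; apply: (@le_trans _ _ ((g v)%:E + (p u v)%:E)%E).
    have := pT u v y; have := p0 u v; rewrite -!EFinD !lee_fin /g => puv.
    case: (lerP (p u y) r) => ?; case: (lerP (p v y) r) => ? ?; lra.
  by rewrite leeD2l// dU; apply: ereal_sup_ubound; exists p.
apply: ereal_sup_ubound; exists g.
  split=> //; last by exists r.
  exact: (Lip1_bounded_Lmu_loc _ d _ _ r).
rewrite /g; have /eqP := pxx y; rewrite eqe => /eqP ->.
by rewrite /r minxx min_l// subr0.
Qed.

(** The exceptional set does not depend on the competitor in the definition of
the intrinsic distance. *)
Lemma intrinsic_dist_le_ae {R : realType} {X : ptopologicalType}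
    {Sigma : set (set X)} {m : {measure set (withSigma Sigma) -> \bar R}}
    (E : dirichlet_form m) (d : X -> X -> \bar R)
    (mu : {measure set (borelX X) -> \bar R}) :
  luzin (R := R) X -> quasi_regular E -> extended_pseudo_distance d ->
  rademacher E d mu -> sobolev_to_lipschitz E d mu ->
  exists2 N : set (withSigma Sigma), m.-negligible N &
    forall x y, ~ N x -> ~ N y -> (intrinsic_dist E mu x y <= d x y)%E.
Proof.
move=> luzX qrE dd rad [_ s2l]; have [d0 _ _ _] := dd.
have L0 : Lmu_tau_loc_b E mu (cst 0).
  split; [|exact: cst_continuous|by exists 0 => x; rewrite normr0].
  apply: (Lip1_bounded_Lmu_loc _ d _ _ 0) => // [|x]; last by rewrite normr0.
  by split=> // x y; rewrite subrr normr0.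
have [|f [_ cf _]//|f_ Lf_ f_P] :=
  luzin_countable_increments X (Lmu_tau_loc_b E mu) luzX.
  by exists (cst 0).
have /choice[fh fhP] : forall n, exists g, Lip1 Sigma d g /\ g = f_ n %[ae m].
  by move=> n; have [Ln _ _] := Lf_ n; have [g ? ?] := s2l _ Ln; exists g.
exists (\bigcup_n ~` [set x | setT x -> fh n x = f_ n x]).
  by apply: negligible_bigcup => n; exact: (fhP n).2.
move=> x y Nx Ny.
have eq_fh z n : ~ (\bigcup_n ~` [set x | setT x -> fh n x = f_ n x]) z ->
    fh n z = f_ n z.
  by move=> Nz; apply: contrapT => fhz; apply: Nz; exists n => // /(_ I).
apply: ge_ereal_sup => _ [f Lf <-]; rewrite leNgt; apply/negP.
case dxy: (d x y) (d0 x y) => [q||]// _; rewrite lte_fin => qf.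
have [n] := f_P f x y q Lf qf.
apply/negP; rewrite -leNgt -!eq_fh// -lee_fin -dxy.
by apply: le_trans ((fhP n).1.2 x y); rewrite lee_fin ler_norm.
Qed.

(** * The maximal function as a distance *)

Theorem theorem4p21 (R : realType) (X : ptopologicalType)
    (Sigma : set (set X)) (m : {measure set (withSigma Sigma) -> \bar R})
    (E : dirichlet_form m) (d : X -> X -> \bar R)
    (mu : {measure set (borelX X) -> \bar R}) :
  luzin_measure_space m ->
  quasi_regular E ->
  strongly_local E ->
  extended_pseudo_distance d ->
  sigma_finite [set: borelX X] mu ->
  not_charging_polar E mu ->
  moderate E mu ->
  rademacher E d mu ->
  sobolev_to_lipschitz E d mu ->
  (forall A : set X, Sigma A -> measurable_fun [set: withSigma Sigma]
    (dist_to d A : withSigma Sigma -> \bar R)) ->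
  admissible d ->
  forall A : set X, Sigma A ->
    exists At : set X,
      [/\ Sigma At, At `<=` A, m.-negligible (A `+` At) &
        [/\ maximal_function E mu A = maximal_function E mu At %[ae m],
            maximal_function E mu At = dist_to d At %[ae m] &
            dist_to d At = dist_to (intrinsic_dist E mu) At %[ae m]]].
Proof.
move=> lms qrE slE dd sfmu ncp mod rad s2l mdist adm A SA.
have aeF : Filter (nbhs (almost_everywhere m)) := ae_filter_ringOfSetsType m.
have [luzX sigmaS borelS _ sfm _] := lms.
have SigmaE : (@measurable _ (withSigma Sigma) : set (set X)) = Sigma.
  exact: sigma_algebra_id.
have mA : measurable (A : set (withSigma Sigma)).
  exact: (@sub_sigma_algebra _ [set: X] Sigma).
(* N0 need not be measurable, hence the measurable null set N containing it. *)
have [N0 [N [mN mN0 N0N]] dmu_le] :=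
  intrinsic_dist_le_ae E d mu luzX qrE dd rad s2l.
have Nnegl : m.-negligible N by apply/negligibleP.
pose C k := [set f : withSigma Sigma -> R | [/\ Lip1 Sigma d f,
  (forall x, 0 <= f x <= k%:R) & \forall x \ae m, A x -> f x = 0]].
have /choice[h_ h_P] : forall k : nat, exists h, C k h /\
    forall f, C k f -> \forall x \ae m, f x <= h x.
  move=> k; have [|||f_ Cf_|h Ch hmax] := essential_greatest m k%:R (C k) sfm.
  - by move=> f [[mf _] _ _].
  - by move=> f x [_ /(_ x)].
  - exists (cst 0); split=> [|x|]; last exact: nearW.
      split=> // x y; rewrite subrr normr0; by case: dd => ->.
    by rewrite lexx ler0n.
  - have f_bnd n x : 0 <= f_ n x <= k%:R by case: (Cf_ n).
    have f_ub x : has_ubound (range (f_ ^~ x)).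
      by exists k%:R => _ [n _ <-]; case/andP: (f_bnd n x).
    split.
    + by apply: Lip1_sup => // n; case: (Cf_ n).
    + move=> x; apply/andP; split.
        have [f0 _] := andP (f_bnd 0%N x); apply: le_trans f0 _.
        by apply: ub_le_sup => //; exists 0%N.
      apply: ge_sup => [|_ [n _ <-]]; first by exists (f_ 0%N x), 0%N.
      by case/andP: (f_bnd n x).
    + have : \forall x \ae m, forall n, A x -> f_ n x = 0.
        by apply: ae_foralln => n; case: (Cf_ n).
      apply: filterS => x fx Ax.
      rewrite (_ : range (f_ ^~ x) = [set 0]) ?sup1//.
      apply/seteqP; split=> [_ [n _ <-]|_ ->]; first exact: fx.
      by exists 0%N => //; exact: fx.
  - by exists h.
(* The h_k vanish a.e. on A, so that At has full measure in A; leaving out N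
   makes d_mu <= d available between points of At and almost every point. *)
pose At : set X := A `&` ~` N `&` [set x | forall k, h_ k x = 0].
have mAt : measurable (At : set (withSigma Sigma)).
  apply: measurableI; first by apply: measurableI => //; exact: measurableC.
  rewrite (_ : [set x | _] = \bigcap_k (h_ k @^-1` [set 0])); last first.
    by apply/seteqP; split=> x hx k; [move=> _; exact: hx|exact: (hx k I)].
  apply: bigcap_measurableType => k _; rewrite -[X in measurable X]setTI.
  have [[[mh _] _ _] _] := h_P k; exact: mh.
have SAt : Sigma At by rewrite -SigmaE.
have AtA : At `<=` A by move=> x [[]].
have AAt0 : m.-negligible (A `\` At : set (withSigma Sigma)).
  have hA : \forall x \ae m, forall k, A x -> h_ k x = 0.
    by apply: ae_foralln => k; case: (h_P k) => [[]].
  apply: negligibleS (negligibleU hA Nnegl).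
  move=> x [Ax nAtx]; have [Nx|nNx] := pselect (N x); first by right.
  by left => /= hx; apply: nAtx; split=> // k; exact: hx.
have h_At k x : ((h_ k x)%:E <= dist_to d At x)%E.
  have [[[_ lip_h] _ _] _] := h_P k.
  apply: le_ereal_inf_tmp => _ [y [_ hy] <-].
  by apply: le_trans (lip_h x y); rewrite hy subr0 lee_fin ler_norm.
have maxAt f (r : R) : Lip1 Sigma d f -> (forall x, 0 <= f x <= r) ->
    (\forall x \ae m, At x -> f x = 0) ->
    \forall x \ae m, ((f x)%:E <= dist_to d At x)%E.
  move=> lipf f_bnd fAt; pose k := (Num.truncn r).+1.
  have rk : r <= k%:R by rewrite ltW// truncnS_gt.
  have : C k f.
    split=> // [x|].
      by have /andP[-> fr] := f_bnd x; rewrite (le_trans fr).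
    have AAt : \forall x \ae m, A x -> At x.
      by apply: negligibleS AAt0 => x /= /not_implyP.
    by move: AAt fAt; apply: filterS2 => x AAtx + Ax; apply; exact: AAtx.
  move/((h_P k).2 f); apply: filterS => x fh.
  by apply: le_trans (h_At k x); rewrite lee_fin.
have mdAt := mdist _ SAt.
have rhoA : is_maximal_function E mu A (dist_to d At).
  exact: is_maximal_function_dist_to.
have rhoAt : is_maximal_function E mu At (dist_to d At).
  apply: is_maximal_function_dist_to => //; rewrite setDv.
  exact: negligible_set0.
have PA := maximal_functionP _ _ _ _ rhoA.
have PAt := maximal_functionP _ _ _ _ rhoAt.
exists At; split=> //.
  by rewrite /setY setUC (_ : At `\` A = set0) ?set0U// setD_eq0.
split=> //.
  by move: PA PAt; apply: filterS2 => x /(_ I)-> /(_ I)->.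
apply: negligibleS Nnegl.
move=> x /= dx; apply: contrapT => Nx; apply: dx => _.
apply/eqP; rewrite eq_le; apply/andP; split.
  apply: le_ereal_inf_tmp => _ [y Aty <-].
  apply: le_trans (le_intrinsic_dist E d mu x y borelS qrE rad dd adm).
  by apply: ereal_inf_lbound; exists y.
apply: le_ereal_inf_tmp => _ [y Aty <-].
apply: (@le_trans _ _ (intrinsic_dist E mu x y)).
  by apply: ereal_inf_lbound; exists y.
have [[_ Ny] _] := Aty.
by apply: dmu_le => /N0N.
Qed.
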